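(* Let $\{\Lambda_i\}_{i\in\mathbb{N}}$ be a countable system of arbitrary closed cones in $\mathbb{R}^n$ satisfying the normal qualification condition at the origin. Then, given a Fréchet normal $x^*\in\widehat N\big(0;\bigcap_{i=1}^\infty\Lambda_i\big)$ and a number $\varepsilon>0$, there are limiting normals $x_i^*\in N(0;\Lambda_i)$, $i\in\mathbb{N}$, such that $$x^*\in\sum_{i=1}^\infty\frac{1}{2^i}x_i^*+\varepsilon\mathbb{B}^*.$$
   Context: $\mathbb{R}^n$ carries the Euclidean norm $\|\cdot\|$ and is identified with its dual; $\mathbb{B}^*$ is the closed unit ball of the dual; $\mathbb{N}=\{1,2,\ldots\}$. A cone is a set $\Lambda$ with $0\in\Lambda$ and $\lambda v\in\Lambda$ whenever $v\in\Lambda$, $\lambda\ge 0$; cones need not be convex. Infinite sums are sums of convergent series. For $\Omega\subset\mathbb{R}^n$, $\bar x\in\Omega$, $\varepsilon\ge 0$, the set of $\varepsilon$-normals is $$\widehat N_\varepsilon(\bar x;\Omega)=\Big\{x^*\Big|\ \limsup_{x\to\bar x,\,x\in\Omega,\,x\neq\bar x}\frac{\langle x^*,x-\bar x\rangle}{\|x-\bar x\|}\le\varepsilon\Big\}$$ (the condition being vacuous if $\bar x$ is isolated in $\Omega$), and $\widehat N(\bar x;\Omega):=\widehat N_0(\bar x;\Omega)$ is the Fréchet normal cone. The limiting normal cone $N(\bar x;\Omega)$ is the set of all $x^*$ for which there are sequences $\varepsilon_k\downarrow 0$, $x_k\to\bar x$ with $x_k\in\Omega$, and $x_k^*\to x^*$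 with $x_k^*\in\widehat N_{\varepsilon_k}(x_k;\Omega)$ for all $k$. Normal qualification condition at the origin for $\{\Lambda_i\}_{i\in\mathbb{N}}$: whenever $x_i^*\in N(0;\Lambda_i)$ for all $i\in\mathbb{N}$ and $\sum_{i=1}^\infty x_i^*=0$, one has $x_i^*=0$ for all $i\in\mathbb{N}$. *)

(* Defs.v *)
From mathcomp Require Import all_boot all_order all_algebra.
From mathcomp Require Import all_classical all_reals all_analysis.
Import Order.TTheory GRing.Theory Num.Theory.
Import numFieldNormedType.Exports.

Set Implicit Arguments.
Unset Strict Implicit.
Unset Printing Implicit Defensive.

Local Open Scope classical_set_scope.
Local Open Scope ring_scope.

Section Normals.
Context {R : realType} {n : nat}.

(* R^n is 'rV[R]_n, identified with its dual through [dot].  The library norm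
   on 'rV[R]_n is the sup norm, so the Euclidean norm is introduced here; the
   library topology on 'rV[R]_n is the usual one. *)
Definition dot (u v : 'rV[R]_n) : R := \sum_(i < n) u 0 i * v 0 i.

Definition enorm (v : 'rV[R]_n) : R := Num.sqrt (dot v v).

Definition dual_ball : set 'rV[R]_n := [set b | enorm b <= 1].

Definition is_cone (L : set 'rV[R]_n) : Prop :=
  L 0 /\ forall (v : 'rV[R]_n) (l : R), L v -> 0 <= l -> L (l *: v).

(* If [x0] is isolated in [Omega], the filter below contains [set0], the upper
   limit is -oo and the condition holds for every [xs].  Meant for [x0] in
   [Omega] and [0 <= e]. *)
Definition eps_normal (e : R) (x0 : 'rV[R]_n) (Omega : set 'rV[R]_n) :
    set 'rV[R]_n :=
  [set xs | (limf_esup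
               (fun x : 'rV[R]_n => (dot xs (x - x0) / enorm (x - x0))%:E)
               (within (Omega `\ x0) (nbhs x0)) <= e%:E)%E].

Definition frechet_normal (x0 : 'rV[R]_n) (Omega : set 'rV[R]_n) :
    set 'rV[R]_n :=
  eps_normal 0 x0 Omega.

Definition limiting_normal (x0 : 'rV[R]_n) (Omega : set 'rV[R]_n) :
    set 'rV[R]_n :=
  [set xs | exists (e : R^nat) (x y : ('rV[R]_n)^nat),
    [/\ forall k, 0 <= e k, nonincreasing_seq e & e @ \oo --> 0] /\
    [/\ forall k, Omega (x k), x @ \oo --> x0,
        forall k, eps_normal (e k) (x k) Omega (y k) & y @ \oo --> xs]].

(* The index [i : nat] stands for [i + 1] in {1, 2, ...}. *)
Definition normal_qualification (L : nat -> set 'rV[R]_n) : Prop :=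
  forall xs : ('rV[R]_n)^nat,
    (forall i, limiting_normal 0 (L i) (xs i)) ->
    series xs @ \oo --> (0 : 'rV[R]_n) ->
    forall i, xs i = 0.

End Normals.

(* Main.v *)
Require Import Defs.
From mathcomp Require Import all_boot all_order all_algebra.
From mathcomp Require Import all_classical all_reals all_analysis.
From mathcomp Require Import ring lra.
Import Order.TTheory GRing.Theory Num.Theory.
Import numFieldNormedType.Exports.
Local Open Scope classical_set_scope.
Local Open Scope ring_scope.

(* Idea.  A Frechet normal [a] to a cone satisfies [<a, v> <= 0] on it, so by
   compactness of the sphere [<a, v> <= eps |v|] already holds on the
   intersection of finitely many of the cones.  For [c = 1, 2, 3, ...]
   minimize the penalty function
     eps |x| - <a, x> + |x|^2 + c * sum_i |x - u_i|^2,   u_i in L_i.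
   At a minimizer the vectors [2 c (x - u_i)] are proximal normals to [L_i] at
   [u_i] whose sum is within [eps] of [a - 2 x], and the minimizers tend to [0]
   as [c] grows.  Normalizing these normals and passing to the limit, the
   qualification condition excludes that they are unbounded, so their limits
   are the required limiting normals; finitely many suffice, and the weights
   [1 / 2 ^ i] are absorbed since the sets of normals are cones.

   Limits of bounded sequences are taken along a free ultrafilter on [nat]
   instead of extracting subsequences. *)

(** * Euclidean inner product and norm *)

Section EuclideanDot.
Context {R : realType} {n : nat}.
Implicit Types (u v w : 'rV[R]_n) (c : R).

Lemma dotC u v : dot u v = dot v u.
Proof. by apply: eq_bigr => i _; rewrite mulrC. Qed.

Lemma dotDl u v w : dot (u + v) w = dot u w + dot v w.
Proof. by rewrite /dot -big_split; apply: eq_bigr => i _; rewrite mxE mulrDl. Qed.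

Lemma dotZl c u v : dot (c *: u) v = c * dot u v.
Proof. by rewrite /dot mulr_sumr; apply: eq_bigr => i _; rewrite mxE mulrA. Qed.

Lemma dotNl u v : dot (- u) v = - dot u v.
Proof. by rewrite -scaleN1r dotZl mulN1r. Qed.

Lemma dotDr u v w : dot w (u + v) = dot w u + dot w v.
Proof. by rewrite !(dotC w) dotDl. Qed.

Lemma dotZr c u v : dot v (c *: u) = c * dot v u.
Proof. by rewrite !(dotC v) dotZl. Qed.

Lemma dotNr u v : dot v (- u) = - dot v u.
Proof. by rewrite !(dotC v) dotNl. Qed.

Lemma dot0l u : dot 0 u = 0.
Proof. by rewrite -(scale0r 0) dotZl mul0r. Qed.

Lemma dot0r u : dot u 0 = 0.
Proof. by rewrite dotC dot0l. Qed.

Lemma dot_suml (I : Type) (r : seq I) (F : I -> 'rV[R]_n) v :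
  dot (\sum_(i <- r) F i) v = \sum_(i <- r) dot (F i) v.
Proof.
elim/big_rec2: _ => [|i x y _ <-]; first by rewrite dot0l.
by rewrite dotDl.
Qed.

Definition dotE := (dotDl, dotDr, dotNl, dotNr, dotZl, dotZr, dot0l, dot0r).

Lemma dot_ge0 u : 0 <= dot u u.
Proof. by apply: sumr_ge0 => i _; rewrite -expr2 sqr_ge0. Qed.

Lemma sqr_coord_le_dot u i : u 0 i ^+ 2 <= dot u u.
Proof.
rewrite /dot (bigD1 i)//= -expr2 lerDl.
by apply: sumr_ge0 => j _; rewrite -expr2 sqr_ge0.
Qed.

Lemma dot_eq0 u : (dot u u == 0) = (u == 0).
Proof.
apply/eqP/eqP => [u0|->]; last by rewrite dot0l.
apply/rowP => i; rewrite mxE; apply/eqP; rewrite -sqrf_eq0 eq_le sqr_ge0 andbT.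
by rewrite -u0 sqr_coord_le_dot.
Qed.

Lemma enorm_ge0 u : 0 <= enorm u.
Proof. exact: sqrtr_ge0. Qed.

Lemma sqr_enorm u : enorm u ^+ 2 = dot u u.
Proof. by rewrite sqr_sqrtr// dot_ge0. Qed.

Lemma enorm_gt0 u : (0 < enorm u) = (u != 0).
Proof. by rewrite sqrtr_gt0 lt_neqAle dot_ge0 andbT eq_sym dot_eq0. Qed.

Lemma enorm0 : enorm (0 : 'rV[R]_n) = 0.
Proof. by rewrite /enorm dot0l sqrtr0. Qed.

Lemma enormZ c u : enorm (c *: u) = `|c| * enorm u.
Proof.
by rewrite /enorm !dotE mulrA -expr2 sqrtrM ?sqr_ge0// sqrtr_sqr.
Qed.

Lemma dot_le_enorm u v : dot u v <= enorm u * enorm v.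
Proof.
have [->|v0] := eqVneq v 0; first by rewrite dot0r mulr_ge0 ?enorm_ge0.
have vv0 : 0 < dot v v by rewrite lt_neqAle dot_ge0 andbT eq_sym dot_eq0.
apply: le_trans (ler_norm _) _; rewrite -ler_sqr ?nnegrE ?mulr_ge0 ?enorm_ge0//.
rewrite exprMn !sqr_enorm real_normK ?num_real// -(ler_pM2l vv0) -subr_ge0.
(* Cauchy-Schwarz: the square of this vector expands to [dot v v * (dot u u * dot v v - dot u v ^+
   2)]. *)
have := dot_ge0 (dot v v *: u - dot u v *: v); rewrite !dotE (dotC v u).
by congr (_ <= _); ring.
Qed.

Lemma ler_enormD u v : enorm (u + v) <= enorm u + enorm v.
Proof.
rewrite -ler_sqr ?nnegrE ?addr_ge0 ?enorm_ge0// sqr_enorm sqrrD !sqr_enorm !dotE.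
rewrite (dotC v u); have := dot_le_enorm u v; lra.
Qed.

End EuclideanDot.

(** * Limits along filters and ultrafilters *)

Section Limits.
Context {R : realType} {n : nat}.

Lemma cvg_dot {T : Type} (F : set_system T) {FF : Filter F} (x y : T -> 'rV[R]_n)
    (a b : 'rV[R]_n) :
  x @ F --> a -> y @ F --> b -> dot (x t) (y t) @[t --> F] --> dot a b.
Proof.
move=> xa yb; apply: cvg_big => [|i _]; first exact: add_continuous.
have coordi : continuous (fun w : 'rV[R]_n => w 0 i) by exact: coord_continuous.
by apply: cvgM; [exact: (continuous_cvg _ (coordi a) xa)|
                 exact: (continuous_cvg _ (coordi b) yb)].
Qed.

Lemma cvg_enorm {T : Type} (F : set_system T) {FF : Filter F} (x : T -> 'rV[R]_n)
    (a : 'rV[R]_n) :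
  x @ F --> a -> enorm (x t) @[t --> F] --> enorm a.
Proof.
move=> xa; apply: (@continuous_cvg _ _ _ _ _ _ Num.sqrt); last exact: cvg_dot.
exact: sqrt_continuous.
Qed.

Lemma ultra_fmap {T V : Type} (f : T -> V) (U : set_system T) :
  UltraFilter U -> UltraFilter (f @ U).
Proof.
move=> UU; split; first exact: fmap_proper_filter.
move=> G GF fUG; apply/seteqP; split=> [A GA|]; last exact: fUG.
have [//|UnA] := in_ultra_setVsetC (f @^-1` A) UU.
have GnA : G (~` A) by exact: fUG.
by have [? []] := filter_ex (filterI GA GnA).
Qed.

(** An ultrafilter on a compact set converges, and the image of [U] under [x] is an ultrafilter on
    the closed ball [dot w w <= c]. *)
Lemma ultra_bounded_cvg {T : Type} (U : set_system T) (x : T -> 'rV[R]_n) (c : R) :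
  UltraFilter U -> (forall t, dot (x t) (x t) <= c) ->
  exists l : 'rV[R]_n, x @ U --> l.
Proof.
move=> UU xc; pose A := [set w : 'rV[R]_n | dot w w <= c].
have cA : compact A.
  apply: bounded_closed_compact.
    exists (c + 1); split=> [|M cM w Aw]; first exact: num_real.
    apply: le_trans (ltW cM).
    have c0 : 0 <= c by exact: le_trans (dot_ge0 w) Aw.
    rewrite /Num.Def.normr /= mx_normrE; apply: bigmax_le => [|[i j] _ /=].
      by rewrite addr_ge0.
    (* The sup-norm bound [c + 1] works because a squared coordinate is at most
       [c <= (c + 1) ^+ 2]. *)
    rewrite -ler_sqr ?nnegrE ?addr_ge0// real_normK ?num_real// ord1.
    apply: (le_trans (sqr_coord_le_dot w j)); apply: (le_trans Aw); nra.
  apply: (@preimage_closed _ _ (fun w : 'rV[R]_n => dot w w) [set r | r <= c]).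
    by move=> w _; apply: (@cvg_dot _ (nbhs w) _ id id); exact: cvg_id.
  exact: closed_le.
move: cA; rewrite compact_ultra => /(_ _ (ultra_fmap x U UU)) [|l [_ xl]].
  exact: (@filterS _ U _ setT _ (fun t _ => xc t) filterT).
by exists l.
Qed.

End Limits.

(** * Proximal, Frechet and limiting normals *)

Section Normals.
Context {R : realType} {n : nat}.
Implicit Types (u v y : 'rV[R]_n) (W : set 'rV[R]_n).

(** The difference quotient is at most [c * enorm (w - u)], which tends to 0 as [w] tends to [u]. *)
Lemma proximal_frechet_normal W u y (c : R) :
  (forall w, W w -> dot y (w - u) <= c * dot (w - u) (w - u)) ->
  frechet_normal u W y.
Proof.
move=> yc; rewrite /frechet_normal /eps_normal /=.
apply/lee_addgt0Pr => e e0; rewrite add0e.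
pose A := [set w | (W `\ u) w /\ c * enorm (w - u) <= e].
apply: (@le_trans _ _ (ereal_sup [set (dot y (x - u) / enorm (x - u))%:E | x in A])).
  apply: ereal_inf_lbound; exists A => //.
  have cvg0 : c * enorm (w - u) @[w --> u] --> c * enorm (u - u).
    have wu : w - u @[w --> u] --> u - u by exact: (cvgB cvg_id (cvg_cst u)).
    exact: (cvgM (cvg_cst c) (cvg_enorm (nbhs u) _ _ wu)).
  rewrite subrr enorm0 mulr0 in cvg0.
  by apply: filterS (cvgr_le _ cvg0 _ e0) => w /= cw Ww; split.
apply: ge_ereal_sup => _ [w [[Ww /eqP wu] we] <-]; rewrite lee_fin.
have wu0 : 0 < enorm (w - u) by rewrite enorm_gt0 subr_eq0.
rewrite ler_pdivrMr//; apply: (le_trans (yc _ Ww)).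
by rewrite -sqr_enorm expr2 mulrA ler_wpM2r// ltW.
Qed.

(** Along the ray through [v] the difference quotient at 0 is constant, and this ray lies in the
    cone and meets every neighbourhood of 0. *)
Lemma frechet_normal_cone_le0 W y v :
  is_cone W -> frechet_normal 0 W y -> W v -> dot y v <= 0.
Proof.
move=> [_ Wcone] yW Wv; have [->|v0] := eqVneq v 0; first by rewrite dot0r.
have nv0 : 0 < enorm v by rewrite enorm_gt0.
suff : dot y v / enorm v <= 0 by rewrite ler_pdivrMr// mul0r.
rewrite -lee_fin; apply: le_trans yW.
apply: le_ereal_inf_tmp => _ [A wA <-]; rewrite /within/= in wA.
have hv0 : (harmonic k : R) *: v @[k --> \oo] --> (0 : 'rV[R]_n).
  by rewrite -(scale0r v); apply: cvgZ; [exact: cvg_harmonic|exact: cvg_cst].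
have Ah : \forall k \near \oo, (W `\ 0) (harmonic k *: v) -> A (harmonic k *: v).
  exact: hv0 wA.
have [k Ak] := filter_ex Ah.
have h0 : 0 < harmonic k :> R by rewrite /harmonic/= invr_gt0.
apply: ereal_sup_ubound; exists (harmonic k *: v).
  apply: Ak; split; first by apply: Wcone => //; exact: ltW.
  by apply/eqP; rewrite scaler_eq0 negb_or v0 gt_eqF.
rewrite subr0 dotZr enormZ gtr0_norm//; congr (_%:E).
by rewrite -mulf_div divff ?gt_eqF// mul1r.
Qed.

(** Turns limits along an ultrafilter back into the sequences of the definition: the k-th term is
    picked within [harmonic k] of both limits, with all tolerances [e k] equal to 0. *)
Lemma limiting_normal_lim {T : Type} (F : set_system T) {FF : ProperFilter F}
    W (x y : T -> 'rV[R]_n) u v :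
  x @ F --> u -> y @ F --> v -> (forall t, W (x t)) ->
  (forall t, frechet_normal (x t) W (y t)) -> limiting_normal u W v.
Proof.
move=> xu yv Wx Nxy.
have /choice[s sP] k : exists t,
    `|u - x t| < harmonic k :> R /\ `|v - y t| < harmonic k :> R.
  have h0 : 0 < harmonic k :> R by rewrite /harmonic/= invr_gt0.
  have := filter_ex (filterI (cvgr_dist_lt _ _ xu _ h0) (cvgr_dist_lt _ _ yv _ h0)).
  by case=> t [xt yt]; exists t.
have cvg_s (z : T -> 'rV[R]_n) w :
    (forall k, `|w - z (s k)| < harmonic k :> R) -> z \o s @ \oo --> w.
  move=> zw; apply/cvgrPdist_lt => e e0.
  apply: filterS (near_infty_natSinv_lt (PosNum e0)) => k ke.
  exact: lt_trans (zw k) ke.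
exists (fun=> 0), (x \o s), (y \o s); split.
  by split=> //; exact: cvg_cst.
split=> [k||k|]; [exact: Wx| |exact: Nxy|]; apply: cvg_s => k;
  by have [] := sP k.
Qed.

End Normals.

(** * The penalty function and existence of minimizers *)

Section Penalty.
Context {R : realType} {n : nat} {I : finType}.
Variables (W : I -> set 'rV[R]_n) (a : 'rV[R]_n) (eps c : R).

(** The term [dot x x] gives coercivity in [x] and later forces the limit of the minimizers to be
    0. *)
Definition penalty (x : 'rV[R]_n) (u : I -> 'rV[R]_n) : R :=
  eps * enorm x - dot a x + dot x x + c * \sum_i dot (x - u i) (x - u i).

Hypotheses (eps_ge0 : 0 <= eps) (c_ge1 : 1 <= c).

Lemma le_sum_dot (u : I -> 'rV[R]_n) i :
  dot (u i) (u i) <= \sum_j dot (u j) (u j).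
Proof. by rewrite (bigD1 i)//= lerDl sumr_ge0// => j _; exact: dot_ge0. Qed.

(** All three bounds come from [2 * dot a x <= dot x x + dot a a], the nonnegativity of the square
    of [x - a]. *)
Lemma penalty_bounds {x u} {b : R} : penalty x u <= b ->
  [/\ - dot a a <= b, dot x x <= 2 * b + dot a a &
      c * \sum_i dot (x - u i) (x - u i) <= b + dot a a].
Proof.
rewrite /penalty => pb.
have s0 : 0 <= \sum_i dot (x - u i) (x - u i).
  by apply: sumr_ge0 => i _; exact: dot_ge0.
have e0 : 0 <= eps * enorm x by rewrite mulr_ge0// enorm_ge0.
have cs0 : 0 <= c * \sum_i dot (x - u i) (x - u i).
  by rewrite mulr_ge0// (le_trans _ c_ge1).
have := dot_ge0 (x - a); have := dot_ge0 x; have := dot_ge0 a.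
rewrite !dotE (dotC x a) => a0 x0 xa0; split; lra.
Qed.

Lemma cvg_penalty {T : Type} (F : set_system T) {FF : Filter F}
    (x : T -> 'rV[R]_n) (u : T -> I -> 'rV[R]_n) x0 u0 :
  x @ F --> x0 -> (forall i, u t i @[t --> F] --> u0 i) ->
  penalty (x t) (u t) @[t --> F] --> penalty x0 u0.
Proof.
move=> xx0 uu0; apply: cvgD; [apply: cvgD; [apply: cvgB|]|].
- by apply: (@cvgM _ _ _ _ (fun=> eps)); [exact: cvg_cst|exact: cvg_enorm].
- by apply: cvg_dot => //; exact: cvg_cst.
- exact: cvg_dot.
- apply: (@cvgM _ _ _ _ (fun=> c)); first exact: cvg_cst.
  apply: cvg_big => [|i _]; first exact: add_continuous.
  by apply: (@cvg_dot _ _ _ F _ (fun t => x t - u t i) (fun t => x t - u t i));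
    exact: cvgB.
Qed.

(** Direct method: along a minimizing sequence [x] and the differences [x - u i] are bounded, so
    they converge along an ultrafilter; closedness keeps the limits of the [u i] in [W i]. *)
Lemma penalty_minimizer :
  (forall i, closed (W i)) -> (forall i, W i 0) ->
  exists (x : 'rV[R]_n) (u : I -> 'rV[R]_n), (forall i, W i (u i)) /\
    forall x' u', (forall i, W i (u' i)) -> penalty x u <= penalty x' u'.
Proof.
move=> Wcl W0.
pose E := [set penalty p.1 p.2 | p in
  [set p : 'rV[R]_n * (I -> 'rV[R]_n) | forall i, W i (p.2 i)]].
have infE : has_inf E.
  split; first by exists (penalty 0 (fun=> 0)), (0, fun=> 0).
  exists (- dot a a) => _ [[x u] _ <-] /=.
  by have [] := penalty_bounds (lexx (penalty x u)).
have E0 : inf E <= 0.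
  apply: (ge_inf infE.2); exists (0, fun=> 0) => //=.
  rewrite /penalty enorm0 dot0r dot0r big1 => [|i _]; last by rewrite subrr dot0r.
  by rewrite !(mulr0, addr0, subrr).
have /choice[p pP] k : exists p : 'rV[R]_n * (I -> 'rV[R]_n),
    (forall i, W i (p.2 i)) /\ penalty p.1 p.2 < inf E + harmonic k.
  have h0 : 0 < harmonic k :> R by rewrite /harmonic/= invr_gt0.
  by have [_ [q qW <-]] := inf_adherent h0 infE; exists q.
have p1 k : penalty (p k).1 (p k).2 <= 1.
  apply: (le_trans (ltW (pP k).2)); rewrite -[leRHS]add0r lerD//.
  by rewrite /harmonic/= invf_le1// ler1n.
have [U [UU oU]] := ultraFilterLemma (@eventually_filter).
have [x xP] : exists x : 'rV[R]_n, (p k).1 @[k --> U] --> x.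
  apply: (@ultra_bounded_cvg _ _ _ U _ (2 * 1 + dot a a)) => k.
  by have [] := penalty_bounds (p1 k).
have /choice[d dP] i :
    exists d : 'rV[R]_n, (p k).1 - (p k).2 i @[k --> U] --> d.
  apply: (@ultra_bounded_cvg _ _ _ U _ (1 + dot a a)) => k.
  have [_ _] := penalty_bounds (p1 k); apply: le_trans.
  apply: le_trans (le_sum_dot (fun i => (p k).1 - (p k).2 i) i) _.
  by rewrite ler_peMl// sumr_ge0// => j _; exact: dot_ge0.
have uP i : (p k).2 i @[k --> U] --> x - d i.
  have -> : (fun k => (p k).2 i) = fun k => (p k).1 - ((p k).1 - (p k).2 i).
    by apply/funext => k; rewrite subKr.
  exact: (cvgB xP (dP i)).
exists x, (fun i => x - d i); split=> [i|x' u' Wu'].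
  apply: (closed_cvg _ (Wcl i) _ _ (uP i)).
  by apply: filterE => k; exact: (pP k).1.
apply: (@le_trans _ _ (inf E)); last first.
  by apply: (ge_inf infE.2); exists (x', u').
have infU : inf E + harmonic k @[k --> U] --> inf E + 0.
  apply: cvgD; first exact: cvg_cst.
  exact: (cvg_trans (cvg_app _ oU) cvg_harmonic).
rewrite -[leRHS]addr0; apply: (ler_cvg_to (cvg_penalty _ _ _ _ _ xP uP) infU).
by apply: filterE => k; exact/ltW/(pP k).2.
Qed.

End Penalty.

(** * First-order conditions at a minimizer *)

Section PenaltyNormals.
Context {R : realType} {n : nat} {I : finType}.
Variables (W : I -> set 'rV[R]_n) (a : 'rV[R]_n) (eps c : R).
Hypotheses (eps_ge0 : 0 <= eps) (c_ge1 : 1 <= c).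
Variables (x : 'rV[R]_n) (u : I -> 'rV[R]_n).
Hypothesis Wu : forall i, W i (u i).
Hypothesis xu_min : forall x' u', (forall i, W i (u' i)) ->
  penalty a eps c x u <= penalty a eps c x' u'.

(** Only [u i] is moved, to [w], and [|x - w|^2 - |x - u i|^2 = |w - u i|^2 - 2 <x - u i, w - u
    i>]. *)
Lemma penalty_minimizer_proximal i w : W i w ->
  dot ((2 * c) *: (x - u i)) (w - u i) <= c * dot (w - u i) (w - u i).
Proof.
move=> Ww; pose u' j := if j == i then w else u j.
have /(xu_min x) : forall j, W j (u' j).
  by move=> j; rewrite /u'; case: eqVneq => [->|].
rewrite /penalty lerD2l (bigD1 i)//= [in X in _ <= X](bigD1 i)//= {1 2}/u' eqxx.
under [X in _ <= _ * (_ + X)]eq_bigr => j ji do rewrite /u' (negbTE ji).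
rewrite !mulrDr lerD2r -subr_ge0 -[in X in _ -> X]subr_ge0.
rewrite !dotE (dotC w x) (dotC (u i) x) (dotC (u i) w).
by congr (_ <= _); ring.
Qed.

(* Obtained by comparing [x] with [x - t g], where [g] is the vector below, as
   [t] tends to 0; no differentiability of the norm is involved. *)
Lemma penalty_minimizer_stationary :
  enorm (\sum_i (2 * c) *: (x - u i) + 2 *: x - a) <= eps.
Proof.
set g := _ - a.
have gE : g = \sum_i (2 * c) *: (x - u i) + 2 *: x - a by [].
(* [K] is the coefficient of [t ^+ 2] in the quadratic terms of the penalty at [x - t *: g]. *)
clearbody g; pose K := (1 + c * #|I|%:R) * dot g g.
have gg : dot g g = 2 * c * (\sum_i dot (x - u i) g) + 2 * dot x g - dot a g.
  rewrite {1}gE !dotE dot_suml; congr (_ + _ - _).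
  by rewrite mulr_sumr; apply: eq_bigr => i _; rewrite dotZl.
have K0 : 0 <= K.
  by rewrite mulr_ge0 ?dot_ge0// addr_ge0// mulr_ge0// (le_trans _ c_ge1).
have sum_gg : \sum_(i : I) dot g g = dot g g * #|I|%:R.
  by rewrite sumr_const mulr_natr.
have step t : 0 < t -> dot g g <= eps * enorm g + t * K.
  move=> t0; have := xu_min (x - t *: g) u Wu; rewrite /penalty.
  have -> : \sum_i dot (x - t *: g - u i) (x - t *: g - u i) =
      \sum_i dot (x - u i) (x - u i) - 2 * t * (\sum_i dot (x - u i) g) +
      t ^+ 2 * (dot g g * #|I|%:R).
    rewrite -sum_gg [2 * t * _]mulr_sumr [t ^+ 2 * _]mulr_sumr.
    rewrite -sumrB -big_split; apply: eq_bigr => i _ /=.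
    rewrite !dotE (dotC g x) (dotC g (u i)) (dotC (u i) x); ring.
  have : eps * enorm (x - t *: g) <= eps * enorm x + eps * t * enorm g.
    rewrite -mulrA -mulrDr ler_wpM2l//.
    rewrite -[t * enorm g]ger0_norm ?mulr_ge0 ?enorm_ge0 ?(ltW t0)//.
    rewrite normrM (ger0_norm (enorm_ge0 g)) -normrN -enormZ scaleNr.
    exact: ler_enormD.
  rewrite !dotE (dotC g x) => le1 le2; rewrite -(ler_pM2l t0).
  set S := \sum_i dot (x - u i) g in gg le2.
  have -> : t * dot g g = t * (2 * c * S + 2 * dot x g - dot a g) by rewrite -gg.
  rewrite /K; nra.
(* Here [t] tends to 0: [t = e / (K + 1)] gives [t * K <= e], even when [K = 0]. *)
have : enorm g ^+ 2 <= eps * enorm g.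
  rewrite sqr_enorm; apply/ler_addgt0Pr => e e0.
  apply: le_trans (step (e / (K + 1)) _) _; first by rewrite divr_gt0// ltr_wpDl.
  by rewrite lerD2l mulrAC ler_pdivrMr ?ltr_wpDl// ler_pM2l// lerDl.
have [<-//|g0] := eqVneq 0 (enorm g).
by rewrite expr2 ler_pM2r// lt_neqAle g0 enorm_ge0.
Qed.

End PenaltyNormals.

(** * Normals to a finite intersection *)

Lemma limiting_normal_0 {R : realType} {n : nat} (W : set 'rV[R]_n) u :
  W u -> limiting_normal u W 0.
Proof.
move=> Wu; apply: (@limiting_normal_lim _ _ nat \oo _ W (fun=> u) (fun=> 0)) => //.
- exact: cvg_cst.
- exact: cvg_cst.
- by move=> _; apply: (proximal_frechet_normal _ _ _ 0) => w _; rewrite dot0l mul0r.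
Qed.

(* The scaling factor [t] spares a separate proof that limiting normals form a
   cone. *)
Lemma finite_intersection_normal {R : realType} {n : nat} {I : finType}
    (W : I -> set 'rV[R]_n) (a : 'rV[R]_n) (eps : R) :
  0 <= eps -> (forall i, closed (W i)) -> (forall i, W i 0) ->
  (forall v, (forall i, W i v) -> dot a v <= eps * enorm v) ->
  (forall z : I -> 'rV[R]_n, (forall i, limiting_normal 0 (W i) (z i)) ->
     \sum_i z i = 0 -> forall i, z i = 0) ->
  exists z : I -> 'rV[R]_n,
    (forall i t, 0 <= t -> limiting_normal 0 (W i) (t *: z i)) /\
    enorm (a - \sum_i z i) <= eps.
Proof.
move=> eps0 Wcl W0 aW qual.
have c1 k : 1 <= k.+1%:R :> R by rewrite ler1n.
have /choice[p pP] k : exists p : 'rV[R]_n * (I -> 'rV[R]_n),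
    (forall i, W i (p.2 i)) /\ forall x' u', (forall i, W i (u' i)) ->
      penalty a eps k.+1%:R p.1 p.2 <= penalty a eps k.+1%:R x' u'.
  have [x [u xu]] := penalty_minimizer W a eps _ eps0 (c1 k) Wcl W0.
  by exists (x, u).
pose x k := (p k).1; pose u i k := (p k).2 i.
pose y i k := (2 * k.+1%:R) *: (x k - u i k).
have Wu i k : W i (u i k) by exact: (pP k).1.
have pen0 k : penalty a eps k.+1%:R (x k) ((p k).2) <= 0.
  apply: (le_trans ((pP k).2 0 (fun=> 0) W0)).
  rewrite /penalty enorm0 dot0r dot0r big1 => [|i _]; last by rewrite subrr dot0r.
  by rewrite !(mulr0, addr0, subrr).
have [U [UU oU]] := ultraFilterLemma (@eventually_filter).
have [x0 xP] : exists x0 : 'rV[R]_n, x @ U --> x0.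
  apply: (@ultra_bounded_cvg _ _ _ U _ (2 * 0 + dot a a)) => k.
  by have [] := penalty_bounds _ _ _ eps0 (c1 k) (pen0 k).
(* The k-th penalty weight is [k.+1] and the minimum is at most 0, so the squared distance is at
   most [dot a a / k.+1]. *)
have dP i : x k - u i k @[k --> U] --> (0 : 'rV[R]_n).
  have dk k : dot (x k - u i k) (x k - u i k) <= dot a a * harmonic k.
    have [_ _] := penalty_bounds _ _ _ eps0 (c1 k) (pen0 k).
    rewrite add0r mulrC -ler_pdivlMr// => /(le_trans _) -> //.
    exact: (le_sum_dot (fun i => x k - u i k) i).
  have [|d dP] := @ultra_bounded_cvg _ _ _ U (fun k => x k - u i k) (dot a a) _.
    move=> k; apply: (le_trans (dk k)).
    by rewrite ler_piMr ?dot_ge0// /harmonic/= invf_le1.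
  have aU : dot a a * harmonic k @[k --> U] --> dot a a * 0.
    apply: (cvgM (cvg_cst (dot a a))).
    exact: (cvg_trans (cvg_app _ oU) cvg_harmonic).
  suff /eqP <- : d == 0 by [].
  rewrite -dot_eq0 eq_le dot_ge0 andbT -(mulr0 (dot a a)).
  by apply: (ler_cvg_to (cvg_dot _ _ _ _ _ dP dP) aU); exact: filterE.
have uP i : u i @ U --> x0.
  have -> : u i = fun k => x k - (x k - u i k).
    by apply/funext => k; rewrite subKr.
  by rewrite -[x in _ --> x]subr0; exact: (cvgB xP (dP i)).
(* As the limit of each [u i], [x0] lies in every [W i], so [dot a x0 <= eps * enorm x0]; the limit
   of the nonpositive minimal values then leaves [dot x0 x0 <= 0]. *)
have x00 : x0 = 0.
  have Wx0 i : W i x0.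
    by apply: (closed_cvg _ (Wcl i) _ _ (uP i)); exact: filterE.
  apply/eqP; rewrite -dot_eq0 eq_le dot_ge0 andbT.
  have lim0 : eps * enorm (x k) - dot a (x k) + dot (x k) (x k) @[k --> U] -->
      eps * enorm x0 - dot a x0 + dot x0 x0.
    apply: (cvgD (cvgB (cvgM (cvg_cst eps) (cvg_enorm _ _ _ xP)) _)).
      exact: (cvg_dot _ _ _ _ _ (cvg_cst a) xP).
    exact: (cvg_dot _ _ _ _ _ xP xP).
  have ax0 := aW _ Wx0.
  suff : eps * enorm x0 - dot a x0 + dot x0 x0 <= 0 by lra.
  apply: (cvgr_to_le lim0); apply: filterE => k.
  apply: le_trans (pen0 k); rewrite /penalty lerDl.
  by rewrite mulr_ge0// sumr_ge0// => i _; exact: dot_ge0.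
rewrite {}x00 in xP uP => {x0}.
(* The scaling keeps both [r] and the [z i] bounded; the summand 1 keeps the denominator positive.
   Unbounded normals would show up as a zero limit of [r]. *)
pose r k := (1 + \sum_i enorm (y i k))^-1.
have den0 k : 0 < 1 + \sum_i enorm (y i k).
  by rewrite ltr_pwDl// sumr_ge0// => i _; exact: enorm_ge0.
have r0 k : 0 < r k by rewrite invr_gt0.
pose z i k := r k *: y i k.
(* This form of [r k] makes it converge along with the [z i]. *)
have rE k : r k = 1 - \sum_i enorm (z i k).
  under eq_bigr do rewrite enormZ gtr0_norm//.
  rewrite -mulr_sumr; apply/eqP; rewrite eq_sym subr_eq -[X in X + _]mulr1 -mulrDr.
  by rewrite mulVf// gt_eqF.
have zi1 i k : enorm (z i k) <= 1.
  apply: (@le_trans _ _ (\sum_i enorm (z i k))).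
    by rewrite (bigD1 i)//= lerDl sumr_ge0// => j _; exact: enorm_ge0.
  by rewrite -subr_ge0 -rE ltW.
have /choice[zl zP] i : exists l : 'rV[R]_n, z i @ U --> l.
  apply: (@ultra_bounded_cvg _ _ _ U _ 1) => k.
  by rewrite -sqr_enorm exprn_ile1 ?enorm_ge0.
pose rl := 1 - \sum_i enorm (zl i).
have rP : r @ U --> rl.
  rewrite (funext rE); apply: cvgB; first exact: cvg_cst.
  apply: cvg_big => [|i _]; first exact: add_continuous.
  exact: cvg_enorm.
have rl0 : 0 <= rl.
  by apply: (cvgr_to_ge rP); apply: filterE => k; exact: ltW.
have zN i t : 0 <= t -> limiting_normal 0 (W i) (t *: zl i).
  move=> t0; apply: (@limiting_normal_lim _ _ nat U _ _ (u i) (fun k => t *: z i k)).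
  - exact: uP.
  - exact: (cvgZ (cvg_cst t) (zP i)).
  - by [].
  - move=> k; apply: (proximal_frechet_normal _ _ _ (t * r k * k.+1%:R)) => w Ww.
    rewrite scalerA dotZl -(mulrA (t * r k)).
    apply: ler_wpM2l; first by rewrite mulr_ge0// ltW.
    exact: penalty_minimizer_proximal (pP k).1 (pP k).2 _ _ Ww.
(* The stationarity estimate, multiplied by [r k], passes to the limit; its term in [x k] vanishes
   because [x] tends to 0. *)
have sumz : enorm (\sum_i zl i - rl *: a) <= rl * eps.
  have lim1 : \sum_i z i k + (2 * r k) *: x k - r k *: a @[k --> U] -->
      \sum_i zl i + (2 * rl) *: 0 - rl *: a.
    apply: cvgB; last exact: (cvgZ rP (cvg_cst a)).
    have r2P : 2 * r k @[k --> U] --> 2 * rl by exact: (cvgM (cvg_cst _) rP).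
    apply: cvgD; last exact: (cvgZ r2P xP).
    by apply: cvg_big => [|i _]; [exact: add_continuous|exact: zP].
  rewrite scaler0 addr0 in lim1.
  apply: (ler_cvg_to (cvg_enorm _ _ _ lim1) (cvgM rP (cvg_cst eps))).
  apply: filterE => k.
  have := penalty_minimizer_stationary _ _ _ _ eps0 (c1 k) _ _ (pP k).1 (pP k).2.
  rewrite -(ler_pM2l (r0 k)) -[X in X * enorm _](gtr0_norm (r0 k)) -enormZ.
  by rewrite scalerBr scalerDr scaler_sumr scalerA [r k * 2]mulrC.
(* If [rl = 0], the [zl i] sum to 0, so they all vanish by qualification; but then [rl = 1] by its
   definition. *)
have rl_gt0 : 0 < rl.
  rewrite lt_neqAle rl0 andbT; apply/eqP => rl00.
  move: sumz; rewrite -rl00 scale0r subr0 mul0r => sumz.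
  have sz0 : \sum_i zl i = 0.
    by apply/eqP; apply: contraTT sumz; rewrite -ltNge enorm_gt0.
  have z0 i : zl i = 0.
    by apply: (qual _ _ sz0 i) => j; rewrite -[zl j]scale1r; exact: zN.
  move: rl00; rewrite /rl big1 => [|i _]; last by rewrite z0 enorm0.
  by apply/eqP; rewrite subr0 eq_sym oner_eq0.
exists (fun i => rl^-1 *: zl i); split=> [i t t0|].
  by rewrite scalerA; apply: zN; rewrite mulr_ge0// invr_ge0.
rewrite -scaler_sumr -(ler_pM2l rl_gt0) -[X in X * enorm _](gtr0_norm rl_gt0).
rewrite -enormZ scalerBr scalerA divff ?gt_eqF// scale1r -opprB -scaleN1r enormZ.
by rewrite normrN normr1 mul1r.
Qed.

(** * Reduction to finitely many cones and conclusion *)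

Lemma finite_intersection_le {R : realType} {n : nat}
    (L : nat -> set 'rV[R]_n) (a : 'rV[R]_n) (eps : R) :
  (forall i, closed (L i)) -> (forall i, is_cone (L i)) ->
  (forall v, (\bigcap_i L i) v -> dot a v <= 0) -> 0 < eps ->
  exists N, forall v, (forall i, (i < N)%N -> L i v) ->
    dot a v <= eps * enorm v.
Proof.
(* Otherwise each [N] gives a unit vector [w N] in the first [N] cones with [eps <= dot a (w N)]; a
   limit of these lies in all the cones and contradicts [aL]. *)
move=> Lcl Lcone aL eps0; apply: contrapT => /forallNP noN.
have /choice[w wP] N : exists w : 'rV[R]_n,
    [/\ forall i, (i < N)%N -> L i w, enorm w = 1 & eps <= dot a w].
  have /existsNP[v /not_implyP[Lv /negP]] := noN N; rewrite -ltNge => av.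
  have v0 : 0 < enorm v.
    rewrite enorm_gt0; apply: contraTneq av => ->.
    by rewrite enorm0 dot0r mulr0 ltxx.
  exists ((enorm v)^-1 *: v); split=> [i iN||].
  - by apply: (Lcone i).2; [exact: Lv|rewrite invr_ge0 ltW].
  - by rewrite enormZ ger0_norm ?invr_ge0 ?(ltW v0)// mulVf// gt_eqF.
  - by rewrite dotZr mulrC ler_pdivlMr// ltW.
have [U [UU oU]] := ultraFilterLemma (@eventually_filter).
have [l wl] : exists l : 'rV[R]_n, w @ U --> l.
  apply: (@ultra_bounded_cvg _ _ _ U _ 1) => k.
  by have [_ w1 _] := wP k; rewrite -sqr_enorm w1 expr1n.
have : eps <= dot a l.
  apply: (cvgr_to_ge (cvg_dot _ _ _ _ _ (cvg_cst a) wl)).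
  by apply: filterE => k; have [] := wP k.
apply/negP; rewrite -ltNge (le_lt_trans _ eps0)//; apply: aL => i _.
(* [w k] lies in [L i] only once [k > i], which holds on a member of [U] because [U] refines the
   eventual filter. *)
apply: (closed_cvg _ (Lcl i) _ _ wl); apply: oU.
by apply: filterS (nbhs_infty_gt i) => k ik; have [Lw _ _] := wP k; exact: Lw.
Qed.

Lemma cvg_series_eventually0 {R : realType} {n : nat} (f : nat -> 'rV[R]_n) N :
  (forall i, (N <= i)%N -> f i = 0) -> series f @ \oo --> \sum_(i < N) f i.
Proof.
move=> f0; apply: cvg_near_cst.
apply: filterS (nbhs_infty_ge N) => k Nk.
rewrite /series/= (big_cat_nat (leq0n N) Nk)//= big_mkord [X in _ + X]big_nat_cond.
by rewrite [X in _ + X]big1 ?addr0// => i /andP[/andP[/f0]].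
Qed.

(* With indices shifted to start at 0, the weight of the i-th normal is
   1 / 2 ^ (i + 1). *)
Theorem theorem5p2 (R : realType) (n : nat) (L : nat -> set 'rV[R]_n)
  (L_closed : forall i, closed (L i))
  (L_cone : forall i, is_cone (L i))
  (L_nqc : normal_qualification L)
  (xstar : 'rV[R]_n)
  (xstar_normal : frechet_normal 0 (\bigcap_i L i) xstar)
  (eps : R) (eps_gt0 : 0 < eps) :
  exists xs : nat -> 'rV[R]_n,
    (forall i, limiting_normal 0 (L i) (xs i)) /\
    exists s b : 'rV[R]_n,
      [/\ series (fun i => (2 ^+ i.+1)^-1 *: xs i) @ \oo --> s,
          dual_ball b & xstar = s + eps *: b].
Proof.
have xL v : (\bigcap_i L i) v -> dot xstar v <= 0.
  apply: frechet_normal_cone_le0 xstar_normal.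
  split=> [i _|w l Lw l0 i _]; first exact: (L_cone i).1.
  by apply: (L_cone i).2 => //; exact: Lw.
have [N xN] := finite_intersection_le _ _ _ L_closed L_cone xL eps_gt0.
(* Padding by 0, a limiting normal to every [L i], turns a finite family into a sequence, so the
   countable qualification condition yields the finite one. *)
pose ext (z : 'I_N -> 'rV[R]_n) i := if insub i is Some j then z j else 0.
have extE z (j : 'I_N) : ext z j = z j by rewrite /ext valK.
have ext0 z i : (N <= i)%N -> ext z i = 0.
  by move=> Ni; rewrite /ext insubF// ltnNge Ni.
have ext_series z : series (ext z) @ \oo --> \sum_j z j.
  rewrite -(eq_bigr _ (fun j _ => extE z j)).
  by apply: cvg_series_eventually0 => i; exact: ext0.
have L0 i : limiting_normal 0 (L i) 0.
  by apply: limiting_normal_0; exact: (L_cone i).1.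
have [||z [zN xz]] := @finite_intersection_normal R n 'I_N (fun i => L i)
    xstar eps (ltW eps_gt0) (fun i => L_closed i) (fun i => (L_cone i).1).
- by move=> v Lv; apply: xN => i iN; exact: (Lv (Ordinal iN)).
- move=> z zN z0 j; rewrite -extE; apply: (L_nqc (ext z)).
    by move=> i; rewrite /ext; case: insubP => [k _ <-|_]; [exact: zN|exact: L0].
  by rewrite -z0; exact: ext_series.
(* The factor cancels the weight of the series; [zN] allows any nonnegative multiple of the
   normals. *)
exists (fun i => 2 ^+ i.+1 *: ext z i); split.
  move=> i; rewrite /ext; case: insubP => [k _ <-|_]; last by rewrite scaler0.
  by apply: zN; rewrite exprn_ge0.
exists (\sum_j z j), (eps^-1 *: (xstar - \sum_j z j)); split.
- have -> : (fun i => (2 ^+ i.+1)^-1 *: (2 ^+ i.+1 *: ext z i)) = ext z.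
    by apply/funext => i; rewrite scalerA mulVf ?expf_neq0// scale1r.
  exact: ext_series.
- rewrite /dual_ball/= enormZ ger0_norm ?invr_ge0 ?(ltW eps_gt0)//.
  by rewrite mulrC ler_pdivrMr// mul1r.
- by rewrite scalerA divff ?gt_eqF// scale1r addrC subrK.
Qed.
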